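(* Assume the reduced operator $\widehat A_h\in\mathbb{R}^{n_h\times n_h}$ is square and invertible. Let $e_\theta\in\mathbb{R}^{n_h}$ solve $\widehat A_he_\theta=r_h$. Then $$U_\theta-Z_he_\theta=U_h^\star .$$ Consequently, $c_{i,h}^{\mathrm{corr}}=\ell_{i,h}^\top U_h^\star$, where $c_{i,h}^{\mathrm{corr}}:=\ell_{i,h}^\top U_\theta-g_{i,h}^\top r_h$.
   Context: Let $U_{0,h}\in\mathbb{R}^{N_h}$ and let $Z_h\in\mathbb{R}^{N_h\times n_h}$ have full column rank. Let $A_h\in\mathbb{R}^{M_h\times N_h}$, $b_h\in\mathbb{R}^{M_h}$, $\widehat A_h:=A_hZ_h$, $\widehat b_h:=b_h-A_hU_{0,h}$. In the square setting $M_h=n_h$. Let $W_h\in\mathbb{R}^{M_h\times M_h}$ be symmetric positive definite and $\widehat H_h:=\widehat A_h^\top W_h\widehat A_h$. The discrete target is $y_h^\star:=\widehat A_h^{-1}\widehat b_h$, $U_h^\star:=U_{0,h}+Z_hy_h^\star$. The vector $U_\theta=U_{0,h}+Z_hy_\theta$ (with $y_\theta\in\mathbb{R}^{n_h}$) is an arbitrary admissible vector, with residual $r_h:=A_hU_\theta-b_h=\widehat A_hy_\theta-\widehat b_h$. For a query vector $\ell_{i,h}\in\mathbb{R}^{N_h}$ put $\widehat\ell_{i,h}:=Z_h^\top\ell_{i,h}$, let $q_{i,h}$ solve $\widehat H_hq_{i,h}=\widehat\ell_{i,h}$, and define $g_{i,h}:=W_h\widehat A_hq_{i,h}$. *)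

(* Defs.v *)
From mathcomp Require Import all_boot all_order all_algebra.
From mathcomp Require Import reals.

Set Implicit Arguments.
Unset Strict Implicit.
Unset Printing Implicit Defensive.

Import GRing.Theory Num.Theory.
Local Open Scope ring_scope.

Section Definitions.
Variables (R : realType) (M N n : nat).
Implicit Types (A : 'M[R]_(M, N)) (Z : 'M[R]_(N, n)) (W : 'M[R]_M).
Implicit Types (b : 'cV[R]_M) (l : 'cV[R]_N) (y q : 'cV[R]_n).

Definition dotv k (u v : 'cV[R]_k) : R := (u^T *m v) 0 0.

Definition sym_posdef k (S : 'M[R]_k) : Prop :=
  S^T = S /\ forall x : 'cV[R]_k, x != 0 -> 0 < dotv x (S *m x).

Definition reduced_op A Z : 'M[R]_(M, n) := A *m Z.

Definition reduced_rhs A b (U0 : 'cV[R]_N) : 'cV[R]_M := b - A *m U0.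

Definition reduced_hess A Z W : 'M[R]_n :=
  (reduced_op A Z)^T *m W *m reduced_op A Z.

Definition admissible_vec (U0 : 'cV[R]_N) Z y : 'cV[R]_N := U0 + Z *m y.

Definition residual A b (U : 'cV[R]_N) : 'cV[R]_M := A *m U - b.

Definition reduced_query Z l : 'cV[R]_n := Z^T *m l.

Definition query_certificate A Z W q : 'cV[R]_M := W *m reduced_op A Z *m q.

Definition corrected_query l (U : 'cV[R]_N) (g r : 'cV[R]_M) : R :=
  dotv l U - dotv g r.

End Definitions.

Section SquareTarget.
Variables (R : realType) (N n : nat).
Variables (A : 'M[R]_(n, N)) (Z : 'M[R]_(N, n)) (b : 'cV[R]_n) (U0 : 'cV[R]_N).

(* [invmx] is the inverse only when its argument is in [unitmx]; otherwise it
   returns the argument, so these are meaningful only for an invertible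
   [reduced_op A Z]. *)
Definition discrete_target_coords : 'cV[R]_n :=
  invmx (reduced_op A Z) *m reduced_rhs A b U0.

Definition discrete_target : 'cV[R]_N :=
  admissible_vec U0 Z discrete_target_coords.

End SquareTarget.

(* Main.v *)
Require Import Defs.
From mathcomp Require Import all_boot all_order all_algebra.
From mathcomp Require Import reals.
Import GRing.Theory Num.Theory.
Local Open Scope ring_scope.

(* The error coordinates recover the target because [y - e] solves the reduced
   system. The certificate identity is the adjoint computation
   [g^T r = q^T Ahat^T W Ahat e = (H q)^T e = l^T Z e], in which the symmetry
   of [W] moves the reduced Hessian [H] onto [q]. *)

Lemma dotvBr (R : realType) (k : nat) (u v w : 'cV[R]_k) :
  dotv u (v - w) = dotv u v - dotv u w.
Proof. by rewrite /dotv mulmxBr !mxE. Qed.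

Lemma discrete_target_coordsE (R : realType) (N n : nat)
    (A : 'M[R]_(n, N)) (Z : 'M[R]_(N, n)) (b : 'cV[R]_n) (U0 : 'cV[R]_N)
    (y e : 'cV[R]_n) :
  reduced_op A Z \in unitmx ->
  reduced_op A Z *m e = residual A b (admissible_vec U0 Z y) ->
  discrete_target_coords A Z b U0 = y - e.
Proof.
move=> Ahat_unit He; rewrite /discrete_target_coords.
suff -> : reduced_rhs A b U0 = reduced_op A Z *m (y - e) by rewrite mulKmx.
(* The residual is [Ahat y] minus the reduced right-hand side, so subtracting it from [Ahat y]
   leaves exactly that right-hand side. *)
rewrite mulmxBr He /reduced_rhs /reduced_op /residual /admissible_vec.
by rewrite mulmxDr mulmxA opprB addrCA opprD [- _ - _]addrC addNKr.
Qed.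

Lemma dotv_query_certificate (R : realType) (M N n : nat)
    (A : 'M[R]_(M, N)) (Z : 'M[R]_(N, n)) (W : 'M[R]_M)
    (l : 'cV[R]_N) (q e : 'cV[R]_n) :
  W^T = W -> reduced_hess A Z W *m q = reduced_query Z l ->
  dotv (query_certificate A Z W q) (reduced_op A Z *m e) = dotv l (Z *m e).
Proof.
move=> W_sym Hq; rewrite /dotv.
(* [l^T Z] is the transpose of the reduced query, which [Hq] expresses through [q]. *)
have -> : l^T *m (Z *m e) = (reduced_hess A Z W *m q)^T *m e.
  by rewrite Hq /reduced_query trmx_mul trmxK mulmxA.
(* With the reduced operator kept atomic as [B], both sides become [q^T B^T W B e]. *)
rewrite /query_certificate /reduced_hess; move: (reduced_op A Z) => B.
by rewrite !trmx_mul trmxK W_sym !mulmxA.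
Qed.

Theorem proposition4p7 (R : realType) (N n : nat)
    (U0 : 'cV[R]_N) (Z : 'M[R]_(N, n)) (A : 'M[R]_(n, N)) (b : 'cV[R]_n)
    (W : 'M[R]_n) (ytheta etheta : 'cV[R]_n)
    (Z_full_col_rank : \rank Z = n)
    (W_spd : sym_posdef W)
    (Ahat_inv : reduced_op A Z \in unitmx) :
  let Utheta := admissible_vec U0 Z ytheta in
  let r := residual A b Utheta in
  let Ustar := discrete_target A Z b U0 in
  reduced_op A Z *m etheta = r ->
  Utheta - Z *m etheta = Ustar /\
  (forall (l : 'cV[R]_N) (q : 'cV[R]_n),
     reduced_hess A Z W *m q = reduced_query Z l ->
     corrected_query l Utheta (query_certificate A Z W q) r = dotv l Ustar).
Proof.
move=> Utheta r Ustar He.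
have UthetaE : Utheta - Z *m etheta = Ustar.
  rewrite /Ustar /discrete_target (@discrete_target_coordsE _ _ _ _ _ _ _ _ _ Ahat_inv He).
  by rewrite /admissible_vec mulmxBr addrA.
split=> // l q Hq.
case: W_spd => W_sym _.
(* Writing [r] as [Ahat e] turns the correction into [l^T Z e]; linearity of [dotv] then reduces the
   claim to the first part. *)
rewrite /corrected_query -He.
by rewrite (@dotv_query_certificate _ _ _ _ _ _ _ _ _ _ W_sym Hq) -dotvBr UthetaE.
Qed.
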